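(* Let $H,A,B\in\mathbb Q$ satisfy $$274A^2-169AB+26B^2+544AH-169BH+274H^2=0 .$$ Define $$C=\frac{13(A+H)}2-B,\qquad D=\frac{167(A+H)}2,\qquad E=163(A+H),\qquad T=170(A+H).$$ Then $$H^3+A^3+B^3+C^3+D^3+E^3=T^3 .$$ *)

(* Defs.v *)
From mathcomp Require Export all_boot all_order all_algebra.

(* Main.v *)
Require Import Defs.
From mathcomp Require Import all_boot all_order all_algebra.
From mathcomp Require Import ring.
Import GRing.Theory.
Local Open Scope ring_scope.

(** Put [s := A + H]. Both sums [H + A = s] and [B + C = 13 s / 2] are multiples
    of [s], and so are [D], [E], [T]; hence [s] divides
    [H^3 + A^3 + B^3 + C^3 + D^3 + E^3 - T^3], with a quadratic form in
    [H], [A], [B] as cofactor. Since [H^3 + A^3 = s (A^2 - A H + H^2)],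
    [B^3 + C^3 = (13 s / 2) ((13 s / 2)^2 - 3 B (13 s / 2 - B))] and
    [(13/2)^3 + (167/2)^3 + 163^3 - 170^3 = 409/2], that cofactor is
    [A^2 - A H + H^2 + 409/2 s^2 - 507/4 B s + 39/2 B^2], which is [3/4] of the
    quadratic form assumed to vanish. *)

Theorem theorem2p2 (H A B C D E T : rat)
  (hHAB : 274 * A ^+ 2 - 169 * A * B + 26 * B ^+ 2 + 544 * A * H
          - 169 * B * H + 274 * H ^+ 2 = 0)
  (hC : C = 13 * (A + H) / 2 - B)
  (hD : D = 167 * (A + H) / 2)
  (hE : E = 163 * (A + H))
  (hT : T = 170 * (A + H)) :
  H ^+ 3 + A ^+ 3 + B ^+ 3 + C ^+ 3 + D ^+ 3 + E ^+ 3 = T ^+ 3.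
Proof.
apply/eqP; rewrite -subr_eq0; apply/eqP.
rewrite -[RHS](mulr0 (3 / 4 * (A + H))) -hHAB hC hD hE hT.
by field.
Qed.
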